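(* Let $G$ be a countable infinite group and let $H$ be any countable maximally almost periodic group. Then there exists a minimal, free $G$-flow $Y$ whose underlying space is homeomorphic to the Cantor set such that $H$ embeds into $\mathrm{Aut}(Y,G)$.
   Context: A group is maximally almost periodic if it admits an injective homomorphism into a compact group. A $G$-flow is minimal if every orbit is dense and free if every point has trivial stabilizer. $\mathrm{Aut}(Y,G)$ is the group of homeomorphisms of $Y$ commuting with the $G$-action. *)

(* Defs.v *)
From Stdlib Require Import List.
Import ListNotations.

Record Group := {
  gcar :> Type;
  gmul : gcar -> gcar -> gcar;
  gone : gcar;
  ginv : gcar -> gcar;
  gmul_assoc : forall x y z, gmul x (gmul y z) = gmul (gmul x y) z;
  gmul_1l : forall x, gmul gone x = x;
  gmul_Vl : forall x, gmul (ginv x) x = gone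
}.

Definition countable (X : Type) : Prop :=
  exists f : X -> nat, forall x y, f x = f y -> x = y.

Definition infinite (X : Type) : Prop :=
  forall l : list X, exists x, ~ In x l.

Definition is_group_hom (G K : Group) (f : G -> K) : Prop :=
  forall x y : G, f (gmul G x y) = gmul K (f x) (f y).

Record Topology (X : Type) := {
  is_open : (X -> Prop) -> Prop;
  open_full : is_open (fun _ => True);
  open_inter : forall U V, is_open U -> is_open V ->
                 is_open (fun x => U x /\ V x);
  open_union : forall F : (X -> Prop) -> Prop,
                 (forall U, F U -> is_open U) ->
                 is_open (fun x => exists U, F U /\ U x)
}.
Arguments is_open {X} t U.

Definition continuous {X Y : Type} (tX : Topology X) (tY : Topology Y)
  (f : X -> Y) : Prop :=
  forall V, is_open tY V -> is_open tX (fun x => V (f x)).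

Definition homeomorphism {X Y : Type} (tX : Topology X) (tY : Topology Y)
  (f : X -> Y) : Prop :=
  exists g : Y -> X,
    (forall x, g (f x) = x) /\ (forall y, f (g y) = y) /\
    continuous tX tY f /\ continuous tY tX g.

Definition homeomorphic {X Y : Type} (tX : Topology X) (tY : Topology Y) : Prop :=
  exists f : X -> Y, homeomorphism tX tY f.

Definition compact {X : Type} (t : Topology X) : Prop :=
  forall F : (X -> Prop) -> Prop,
    (forall U, F U -> is_open t U) ->
    (forall x, exists U, F U /\ U x) ->
    exists l : list (X -> Prop),
      (forall U, In U l -> F U) /\ (forall x, exists U, In U l /\ U x).

Definition hausdorff {X : Type} (t : Topology X) : Prop :=
  forall x y : X, x <> y ->
    exists U V, is_open t U /\ is_open t V /\ U x /\ V y /\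
                (forall z, ~ (U z /\ V z)).

Definition dense {X : Type} (t : Topology X) (A : X -> Prop) : Prop :=
  forall U, is_open t U -> (exists x, U x) -> exists x, U x /\ A x.

Definition prod_open {X Y : Type} (tX : Topology X) (tY : Topology Y)
  (W : X * Y -> Prop) : Prop :=
  forall p, W p -> exists A B, is_open tX A /\ is_open tY B /\
     A (fst p) /\ B (snd p) /\ (forall a b, A a -> B b -> W (a, b)).

Definition prod_continuous {X Y Z : Type} (tX : Topology X) (tY : Topology Y)
  (tZ : Topology Z) (f : X -> Y -> Z) : Prop :=
  forall V, is_open tZ V -> prod_open tX tY (fun p => V (f (fst p) (snd p))).

Definition topological_group (K : Group) (t : Topology K) : Prop :=
  prod_continuous t t t (gmul K) /\ continuous t t (ginv K).

Definition compact_group (K : Group) (t : Topology K) : Prop :=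
  topological_group K t /\ compact t /\ hausdorff t.

Definition maximally_almost_periodic (H : Group) : Prop :=
  exists (K : Group) (t : Topology K) (f : H -> K),
    compact_group K t /\ is_group_hom H K f /\
    (forall x y, f x = f y -> x = y).

Definition cantor_open (W : (nat -> bool) -> Prop) : Prop :=
  forall f, W f -> exists n, forall g, (forall k, k < n -> g k = f k) -> W g.

Lemma cantor_open_full : cantor_open (fun _ => True).
Proof. intros f _; exists 0; auto. Qed.

Lemma cantor_open_inter : forall U V, cantor_open U -> cantor_open V ->
  cantor_open (fun x => U x /\ V x).
Proof.
  intros U V hU hV f [Uf Vf].
  destruct (hU f Uf) as [n hn]; destruct (hV f Vf) as [m hm].
  exists (n + m); intros g hg; split.
  - apply hn; intros k hk; apply hg; apply PeanoNat.Nat.lt_lt_add_r; exact hk.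
  - apply hm; intros k hk; apply hg; rewrite PeanoNat.Nat.add_comm;
      apply PeanoNat.Nat.lt_lt_add_r; exact hk.
Qed.

Lemma cantor_open_union : forall F : ((nat -> bool) -> Prop) -> Prop,
  (forall U, F U -> cantor_open U) ->
  cantor_open (fun x => exists U, F U /\ U x).
Proof.
  intros F hF f [U [FU Uf]].
  destruct (hF U FU f Uf) as [n hn]; exists n; intros g hg; exists U; auto.
Qed.

Definition cantor_topology : Topology (nat -> bool) :=
  {| is_open := cantor_open;
     open_full := cantor_open_full;
     open_inter := cantor_open_inter;
     open_union := cantor_open_union |}.

Definition is_flow (G : Group) {Y : Type} (t : Topology Y)
  (act : G -> Y -> Y) : Prop :=
  (forall y, act (gone G) y = y) /\
  (forall g h y, act (gmul G g h) y = act g (act h y)) /\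
  (forall g, continuous t t (act g)).

Definition minimal_flow (G : Group) {Y : Type} (t : Topology Y)
  (act : G -> Y -> Y) : Prop :=
  forall y, dense t (fun z => exists g, z = act g y).

Definition free_flow (G : Group) {Y : Type} (act : G -> Y -> Y) : Prop :=
  forall g y, act g y = y -> g = gone G.

Definition in_Aut (G : Group) {Y : Type} (t : Topology Y)
  (act : G -> Y -> Y) (phi : Y -> Y) : Prop :=
  homeomorphism t t phi /\ (forall g y, phi (act g y) = act g (phi y)).

Definition embeds_into_Aut (H G : Group) {Y : Type} (t : Topology Y)
  (act : G -> Y -> Y) : Prop :=
  exists phi : H -> Y -> Y,
    (forall h, in_Aut G t act (phi h)) /\
    (forall h1 h2 y, phi (gmul H h1 h2) y = phi h1 (phi h2 y)) /\
    (forall h1 h2, (forall y, phi h1 y = phi h2 y) -> h1 = h2).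

(* Main.v *)
(** A family [Z] of maps [z : G -> X] is strongly irreducible when partial points
    of [Z] on far apart regions can be glued together.  Requiring a pattern of [Z] to
    occur around every point of some maximal separated subset [C] of [G] makes that
    pattern syndetic and keeps strong irreducibility, since maximal separated subsets
    can themselves be glued.  Iterating over all patterns and taking closures gives a minimal flow; proper
    colorings of the graphs [k -- g k], introduced in fresh coordinates, make it free.
    To keep [H] acting, symbols carry a component in [H], and a pattern is planted in
    the shape of finitely many translates [h t z1], [t] in [T], with [h] arbitrary:
    [H] being totally bounded, some [h t] is close to [1], so one of them shows the
    required pattern.  Elements of [H] are read off through clopen subsets of the
    countable, hence zero-dimensional, image of [H] in the compact group. *)
From Stdlib Require Import List Arith Lia Classical ClassicalEpsilon
  FunctionalExtensionality PropExtensionality ProofIrrelevance Cantor.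
Require Import Defs.
Import ListNotations.

(** * Group identities and finite product sets *)

Lemma gcancel_Vl (G : Group) (x y : G) : gmul G (ginv G x) (gmul G x y) = y.
Proof. rewrite gmul_assoc, gmul_Vl, gmul_1l; reflexivity. Qed.

Lemma gmul_cancel_l (G : Group) (x y z : G) : gmul G x y = gmul G x z -> y = z.
Proof.
  intros e; rewrite <- (gcancel_Vl G x y), e; apply gcancel_Vl.
Qed.

Lemma gmul_1r (G : Group) (x : G) : gmul G x (gone G) = x.
Proof.
  apply (gmul_cancel_l G (ginv G x)).
  rewrite gmul_assoc, gmul_Vl, gmul_1l; reflexivity.
Qed.

Lemma gmul_Vr (G : Group) (x : G) : gmul G x (ginv G x) = gone G.
Proof.
  apply (gmul_cancel_l G (ginv G x)).
  rewrite gmul_assoc, gmul_Vl, gmul_1l, gmul_1r; reflexivity.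
Qed.

Lemma gcancel_Vr (G : Group) (x y : G) : gmul G x (gmul G (ginv G x) y) = y.
Proof. rewrite gmul_assoc, gmul_Vr, gmul_1l; reflexivity. Qed.

Lemma ginv_inv (G : Group) (x : G) : ginv G (ginv G x) = x.
Proof. apply (gmul_cancel_l G (ginv G x)); rewrite gmul_Vr, gmul_Vl; reflexivity. Qed.

Lemma ginv_1 (G : Group) : ginv G (gone G) = gone G.
Proof. rewrite <- (gmul_1l G (ginv G (gone G))); apply gmul_Vr. Qed.

Lemma ginv_mul (G : Group) (x y : G) :
  ginv G (gmul G x y) = gmul G (ginv G y) (ginv G x).
Proof.
  apply (gmul_cancel_l G (gmul G x y)).
  rewrite gmul_Vr, <- gmul_assoc, gcancel_Vr, gmul_Vr; reflexivity.
Qed.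

Create HintDb grp.
Hint Rewrite gmul_1l gmul_1r gmul_Vl gmul_Vr gcancel_Vl gcancel_Vr ginv_inv
  ginv_1 ginv_mul : grp.
Ltac grp := repeat rewrite <- gmul_assoc; autorewrite with grp;
  repeat (progress (repeat rewrite <- gmul_assoc; autorewrite with grp));
  try reflexivity.

Lemma gmul_cancel_r (G : Group) (x y z : G) : gmul G y x = gmul G z x -> y = z.
Proof.
  intros e; assert (h : gmul G (gmul G y x) (ginv G x)
                       = gmul G (gmul G z x) (ginv G x)) by (rewrite e; reflexivity).
  revert h; grp; auto.
Qed.

Definition lmul (G : Group) (A B : list G) : list G :=
  flat_map (fun a => map (gmul G a) B) A.

Lemma in_lmul (G : Group) (A B : list G) (a b : G) :
  In a A -> In b B -> In (gmul G a b) (lmul G A B).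
Proof.
  intros ha hb; apply in_flat_map; exists a; split; auto.
  apply in_map; auto.
Qed.

Definition linv (G : Group) (A : list G) : list G := map (ginv G) A.

Lemma in_linv (G : Group) (A : list G) (a : G) : In a A -> In (ginv G a) (linv G A).
Proof. apply in_map. Qed.

Lemma in_linv_inv (G : Group) (A : list G) (a : G) :
  In (ginv G a) A -> In a (linv G A).
Proof. intros h; rewrite <- (ginv_inv G a); apply in_map; auto. Qed.

Lemma linv_in (G : Group) (A : list G) (a : G) : In a (linv G A) -> In (ginv G a) A.
Proof.
  intros h; apply in_map_iff in h as [b [<- hb]]; rewrite ginv_inv; auto.
Qed.

(** * Countability, choice and bounds *)

Lemma countable_prod (A B : Type) : countable A -> countable B -> countable (A * B).
Proof.
  intros [f hf] [g hg]; exists (fun p => Cantor.to_nat (f (fst p), g (snd p))).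
  intros [a b] [a' b'] e; cbn [fst snd] in e.
  apply Cantor.to_nat_inj in e; inversion e; f_equal; auto.
Qed.

Lemma countable_sum (A B : Type) : countable A -> countable B -> countable (A + B).
Proof.
  intros [f hf] [g hg].
  exists (fun s => match s with inl a => 2 * f a | inr b => S (2 * g b) end).
  intros [a|b] [a'|b'] e; try lia; f_equal; [apply hf | apply hg]; lia.
Qed.

Lemma countable_bool : countable bool.
Proof. exists (fun b : bool => if b then 1 else 0); intros [] []; lia || auto. Qed.

Lemma countable_nat : countable nat.
Proof. exists (fun n => n); auto. Qed.

Lemma countable_list (A : Type) : countable A -> countable (list A).
Proof.
  intros [f hf].
  exists (fix code l := match l with nil => 0
                        | x :: l' => S (Cantor.to_nat (f x, code l')) end).
  intros l; induction l as [|x l IH]; intros [|y l'] e; try discriminate; auto.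
  apply eq_add_S, Cantor.to_nat_inj in e; inversion e; f_equal; auto.
Qed.

Lemma dependent_choice {A : Type} (P : nat -> A -> Prop) (R : nat -> A -> A -> Prop)
  (a0 : A) :
  P 0 a0 -> (forall n a, P n a -> exists b, P (S n) b /\ R n a b) ->
  exists s : nat -> A, s 0 = a0 /\ forall n, P n (s n) /\ R n (s n) (s (S n)).
Proof.
  intros h0 hs.
  pose (next := fun n (a : A) =>
    epsilon (inhabits a0) (fun b => P (S n) b /\ R n a b)).
  pose (s := fix s n := match n with 0 => a0 | S n' => next n' (s n') end).
  assert (hP : forall n, P n (s n)).
  { intros n; induction n as [|n IH]; [exact h0|].
    exact (proj1 (epsilon_spec (inhabits a0) _ (hs n (s n) IH))). }
  exists s; split; [reflexivity|]; intros n; split; [apply hP|].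
  exact (proj2 (epsilon_spec (inhabits a0) _ (hs n (s n) (hP n)))).
Qed.

Lemma finite_bound {A : Type} (f : A -> nat) (l : list A) :
  exists N, forall x, In x l -> f x < N.
Proof.
  induction l as [|x l [N hN]]; [exists 0; intros ? []|].
  exists (S (f x) + N); intros y [<-|hy]; [lia|]; specialize (hN y hy); lia.
Qed.

Lemma least_nat (P : nat -> Prop) :
  (exists n, P n) -> exists n, P n /\ forall m, m < n -> ~ P m.
Proof.
  intros [n hn]; revert hn; induction n as [n IH] using lt_wf_ind; intros hn.
  destruct (classic (exists m, m < n /\ P m)) as [[m [hm pm]]|no].
  - exact (IH m hm pm).
  - exists n; split; auto; intros m hm pm; apply no; exists m; auto.
Qed.

(** * Zero-dimensional perfect compacta *)

Section Pointwise.
Context {I : Type} (Y : (I -> bool) -> Prop).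

Definition pw_open (W : sig Y -> Prop) : Prop :=
  forall y, W y -> exists l : list I, forall y' : sig Y,
    (forall i, In i l -> proj1_sig y' i = proj1_sig y i) -> W y'.

Lemma pw_open_full : pw_open (fun _ => True).
Proof. intros y _; exists nil; auto. Qed.

Lemma pw_open_inter : forall U V, pw_open U -> pw_open V ->
  pw_open (fun x => U x /\ V x).
Proof.
  intros U V hU hV y [Uy Vy].
  destruct (hU y Uy) as [l hl]; destruct (hV y Vy) as [m hm].
  exists (l ++ m); intros y' h; split; [apply hl | apply hm];
    intros i hi; apply h; apply in_or_app; auto.
Qed.

Lemma pw_open_union : forall F : (sig Y -> Prop) -> Prop,
  (forall U, F U -> pw_open U) -> pw_open (fun x => exists U, F U /\ U x).
Proof.
  intros F hF y [U [FU Uy]]; destruct (hF U FU y Uy) as [l hl].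
  exists l; intros y' h; exists U; auto.
Qed.

Definition pw_topology : Topology (sig Y) :=
  {| is_open := pw_open; open_full := pw_open_full;
     open_inter := pw_open_inter; open_union := pw_open_union |}.

Lemma sig_ext (y y' : sig Y) :
  (forall i, proj1_sig y i = proj1_sig y' i) -> y = y'.
Proof.
  destruct y as [y hy], y' as [y' hy']; simpl; intros e.
  assert (e' : y = y') by (extensionality i; auto).
  subst y'; f_equal; apply proof_irrelevance.
Qed.

Lemma pw_continuous (phi : sig Y -> sig Y) (r : I -> I) :
  (forall y i, proj1_sig (phi y) i = proj1_sig y (r i)) ->
  continuous pw_topology pw_topology phi.
Proof.
  intros h V hV y Vy; destruct (hV _ Vy) as [l hl].
  exists (map r l); intros y' e; apply hl; intros i hi.
  rewrite !h; apply e, in_map, hi.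
Qed.

Definition pw_closed : Prop :=
  forall y : I -> bool,
    (forall l, exists y', Y y' /\ forall i, In i l -> y' i = y i) -> Y y.

Definition pw_perfect : Prop :=
  forall (y : sig Y) (l : list I), exists y' : sig Y,
    y' <> y /\ forall i, In i l -> proj1_sig y' i = proj1_sig y i.

Context (code : I -> nat) (code_inj : forall i j, code i = code j -> i = j).
Context (closedY : pw_closed) (perfectY : pw_perfect) (y0 : sig Y).

(** Partial inverse of [code]: all entries of the list are one and the same index, and the empty
    list replaces a default index. *)
Definition dec (n : nat) : list I :=
  epsilon (inhabits nil) (fun l => forall i, In i l <-> code i = n).

Lemma dec_spec n i : In i (dec n) <-> code i = n.
Proof.
  revert i; unfold dec; apply epsilon_spec.
  destruct (classic (exists i, code i = n)) as [[i <-]|no].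
  - exists [i]; intros j; split; [intros [->|[]]; auto | left; auto].
  - exists nil; intros j; split; [intros [] | intros e; apply no; exists j; auto].
Qed.

Definition bit (y : sig Y) (n : nat) : bool :=
  existsb (proj1_sig y) (dec n).

Lemma bit_code y i : bit y (code i) = proj1_sig y i.
Proof.
  unfold bit; apply Bool.eq_iff_eq_true; rewrite existsb_exists; split.
  - intros [j [hj e]]; apply dec_spec, code_inj in hj; subst j; auto.
  - intros e; exists i; split; auto; apply dec_spec; auto.
Qed.

Definition agr (n : nat) (y y' : sig Y) : Prop :=
  forall m, m < n -> bit y m = bit y' m.

Lemma agr_window n : exists l : list I, forall y y' : sig Y,
  (forall i, In i l -> proj1_sig y' i = proj1_sig y i) -> agr n y y'.
Proof.
  exists (flat_map dec (seq 0 n)); intros y y' h m hm; unfold bit.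
  assert (e : forall i, In i (dec m) -> proj1_sig y' i = proj1_sig y i).
  { intros i hi; apply h, in_flat_map; exists m; split; auto; apply in_seq; lia. }
  revert e; generalize (dec m); intros l; induction l as [|i l IH]; simpl; auto.
  intros e; rewrite e, IH; auto.
Qed.

Lemma agr_ext (y y' : sig Y) : (forall n, agr n y y') -> y = y'.
Proof.
  intros h; apply sig_ext; intros i; rewrite <- !bit_code.
  apply (h (S (code i))); lia.
Qed.

(** Perfectness gives a second point in the cylinder, hence a bit that is not constant on it. For
    the least such [m] the whole cylinder agrees with [y] before [m], and both values of bit [m] are
    taken. *)
Lemma split_exists (y : sig Y) (n : nat) :
  exists (m : nat) (z : bool -> sig Y), n <= m /\
    (forall b, agr m y (z b) /\ bit (z b) m = b) /\
    forall y', agr n y y' -> agr m y y'.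
Proof.
  destruct (least_nat (fun m => exists y', agr n y y' /\ bit y m <> bit y' m))
    as [m [[y1 [h1 d1]] hm]].
  { destruct (agr_window n) as [l hl]; destruct (perfectY y l) as [y' [ne e]].
    apply NNPP; intros no; apply ne, agr_ext; intros k m _.
    destruct (Bool.bool_dec (bit y m) (bit y' m)) as [q|q]; auto.
    exfalso; apply no; exists m, y'; split; auto. }
  assert (ext : forall y', agr n y y' -> agr m y y').
  { intros y' h' k hk; apply NNPP; intros d; apply (hm k hk); exists y'; auto. }
  exists m, (fun b => if Bool.bool_dec b (bit y m) then y else y1).
  split; [|split; auto].
  - destruct (le_lt_dec n m) as [|lt]; auto; exfalso; apply d1, h1, lt.
  - intros b; destruct (Bool.bool_dec b (bit y m)) as [->|ne].
    + split; auto; intros k _; auto.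
    + split; auto; destruct b, (bit y m), (bit y1 m); congruence.
Qed.

Definition split_at (y : sig Y) (n : nat) : nat :=
  proj1_sig (constructive_indefinite_description _ (split_exists y n)).

Definition split_to (y : sig Y) (n : nat) : bool -> sig Y :=
  proj1_sig (constructive_indefinite_description _
    (proj2_sig (constructive_indefinite_description _ (split_exists y n)))).

Lemma split_spec y n : n <= split_at y n /\
  (forall b, agr (split_at y n) y (split_to y n b) /\
             bit (split_to y n b) (split_at y n) = b) /\
  forall y', agr n y y' -> agr (split_at y n) y y'.
Proof. unfold split_to; apply proj2_sig. Qed.

(* A state [(y, n)] stands for the cylinder of the points agreeing with [y] on the
   first [n] bits; it splits at the first bit not constant on it. *)
Definition branch (c : sig Y * nat) : nat := split_at (fst c) (snd c).

Definition step (c : sig Y * nat) (b : bool) : sig Y * nat :=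
  (split_to (fst c) (snd c) b, S (branch c)).

(** A walk down the binary splitting tree: here [x] dictates the branch at each splitting, whereas
    [track] takes the branch that contains [y]. *)
Fixpoint down (x : nat -> bool) (i : nat) : sig Y * nat :=
  match i with 0 => (y0, 0) | S i => step (down x i) (x i) end.

Fixpoint track (y : sig Y) (i : nat) : sig Y * nat :=
  match i with
  | 0 => (y0, 0)
  | S i => step (track y i) (bit y (branch (track y i)))
  end.

Definition to_cantor (y : sig Y) (i : nat) : bool := bit y (branch (track y i)).

Lemma down_to_cantor y i : down (to_cantor y) i = track y i.
Proof. induction i as [|i IH]; simpl; auto; rewrite IH; auto. Qed.

Lemma down_local x x' i : (forall k, k < i -> x k = x' k) -> down x i = down x' i.
Proof.
  induction i as [|i IH]; simpl; auto; intros h.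
  rewrite IH, h by (intros; try apply h; lia); auto.
Qed.

Lemma branch_ge c : snd c <= branch c.
Proof. apply split_spec. Qed.

Lemma down_len x i : i <= snd (down x i).
Proof.
  induction i as [|i IH]; simpl; [lia|]; pose proof (branch_ge (down x i)); lia.
Qed.

Lemma down_agr x i j : i <= j -> agr (snd (down x i)) (fst (down x i)) (fst (down x j)).
Proof.
  intros h; induction h as [|j h IH]; [intros k _; auto|].
  assert (mono : snd (down x i) <= snd (down x j)).
  { clear IH; induction h as [|j h IH]; auto; simpl.
    pose proof (branch_ge (down x j)); lia. }
  intros k hk; rewrite (IH k hk); simpl.
  destruct (split_spec (fst (down x j)) (snd (down x j))) as [le [h1 _]].
  apply (h1 (x j)); lia.
Qed.

Lemma track_agr y i : agr (snd (track y i)) (fst (track y i)) y.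
Proof.
  induction i as [|i IH]; simpl; [intros k hk; lia|]; intros k hk.
  destruct (split_spec (fst (track y i)) (snd (track y i))) as [le [h1 h2]].
  set (b := bit y (branch (track y i))); destruct (h1 b) as [h3 h4].
  destruct (Nat.eq_dec k (branch (track y i))) as [->|ne].
  - exact h4.
  - assert (lt : k < branch (track y i)) by lia.
    rewrite <- (h3 k lt); apply (h2 y IH k lt).
Qed.

(** The cylinders met along [x] shrink to one point. Coordinate [i] is read at step [S (code i)],
    where the cylinder already fixes more than [code i] bits. *)
Definition lim_fun (x : nat -> bool) (i : I) : bool :=
  proj1_sig (fst (down x (S (code i)))) i.

Lemma lim_fun_in x : Y (lim_fun x).
Proof.
  apply closedY; intros l; destruct (finite_bound code l) as [N hN].
  exists (proj1_sig (fst (down x N))); split; [apply proj2_sig|].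
  intros i hi; unfold lim_fun; rewrite <- !bit_code; symmetry.
  apply (down_agr x (S (code i)) N); [apply hN, hi|].
  apply (down_len x (S (code i))).
Qed.

Definition of_cantor (x : nat -> bool) : sig Y := exist _ (lim_fun x) (lim_fun_in x).

Lemma bit_no_code y n : (forall i, code i <> n) -> bit y n = false.
Proof.
  intros h; unfold bit; apply Bool.not_true_iff_false; intros e.
  apply existsb_exists in e as [i [hi _]]; apply dec_spec in hi; apply (h i hi).
Qed.

Lemma of_cantor_agr x i : agr (snd (down x i)) (fst (down x i)) (of_cantor x).
Proof.
  intros k hk; destruct (classic (exists j, code j = k)) as [[j <-]|no].
  - rewrite (bit_code (of_cantor x)); simpl; unfold lim_fun; rewrite <- bit_code.
    destruct (le_lt_dec i (S (code j))) as [le|lt].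
    + apply (down_agr x i _ le), hk.
    + symmetry; apply (down_agr x (S (code j)) i); [lia|].
      apply (down_len x (S (code j))).
  - rewrite !bit_no_code; auto; intros j e; apply no; exists j; auto.
Qed.

(** By induction: the limit lies in the cylinder of step [S i], so its bit at the [i]-th splitting
    is [x i]. *)
Lemma track_of_cantor x i : track (of_cantor x) i = down x i.
Proof.
  induction i as [|i IH]; simpl; auto; rewrite IH; f_equal.
  rewrite <- (of_cantor_agr x (S i) (branch (down x i))) by (simpl; lia).
  apply split_spec.
Qed.

Lemma of_to y : of_cantor (to_cantor y) = y.
Proof.
  apply agr_ext; intros n k hk.
  assert (lt : k < snd (down (to_cantor y) n))
    by (pose proof (down_len (to_cantor y) n); lia).
  rewrite <- (of_cantor_agr _ n k lt); rewrite down_to_cantor in *.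
  apply track_agr, lt.
Qed.

Lemma to_of x : to_cantor (of_cantor x) = x.
Proof.
  extensionality i; unfold to_cantor; rewrite track_of_cantor.
  rewrite <- (of_cantor_agr x (S i) (branch (down x i))) by (simpl; lia).
  apply split_spec.
Qed.

Lemma track_local y y' i : agr (snd (track y i)) y y' -> track y i = track y' i.
Proof.
  induction i as [|i IH]; simpl; auto; intros h.
  rewrite <- IH; [rewrite (h (branch (track y i))) by lia; auto|].
  intros k hk; apply h; pose proof (branch_ge (track y i)); lia.
Qed.

Lemma homeomorphic_cantor : homeomorphic pw_topology cantor_topology.
Proof.
  exists to_cantor, of_cantor; split; [exact of_to|]; split; [exact to_of|]; split.
  (* The first [n] choices depend only on the bits below [snd (track y n)]. *)
  - intros V hV y Vy; destruct (hV _ Vy) as [n hn].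
    destruct (agr_window (snd (track y n))) as [l hl]; exists l.
    intros y' h; apply hn; intros k hk; specialize (hl y y' h).
    assert (mono : snd (track y (S k)) <= snd (track y n)).
    { clear - hk; induction hk as [|n hk IH]; auto; simpl in *.
      pose proof (branch_ge (track y n)); lia. }
    assert (e : track y k = track y' k).
    { apply track_local; intros r hr; apply hl; simpl in mono.
      pose proof (branch_ge (track y k)); lia. }
    unfold to_cantor; rewrite <- e; symmetry; apply hl; simpl in mono; lia.
  (* Coordinate [i] of the preimage uses only the first [S (code i)] choices, so a bound on the
     codes in [l] suffices. *)
  - intros V hV x Vx; destruct (hV _ Vx) as [l hl].
    destruct (finite_bound code l) as [N hN]; exists N.
    intros x' h; apply hl; intros i hi; simpl; unfold lim_fun.
    rewrite (down_local x' x); auto; intros k hk; apply h.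
    specialize (hN i hi); lia.
Qed.

End Pointwise.

(** * Almost periodicity in a compact group *)

Lemma open_of_nbhd {X : Type} (t : Topology X) (W : X -> Prop) :
  (forall x, W x -> exists O, is_open t O /\ O x /\ forall y, O y -> W y) ->
  is_open t W.
Proof.
  intros h; pose (F := fun O => is_open t O /\ forall y, O y -> W y).
  replace W with (fun x => exists U, F U /\ U x).
  - apply open_union; intros U [hU _]; exact hU.
  - extensionality x; apply propositional_extensionality; split.
    + intros [U [[_ hU] Ux]]; auto.
    + intros Wx; destruct (h x Wx) as [O [hO [Ox sub]]]; exists O; repeat split; auto.
Qed.

Section TopGroup.
Context (K : Group) (t : Topology K) (topK : topological_group K t).

Lemma open_mul (V : K -> Prop) (a b : K) : is_open t V -> V (gmul K a b) ->
  exists A B, is_open t A /\ is_open t B /\ A a /\ B b /\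
    forall x y, A x -> B y -> V (gmul K x y).
Proof. intros hV h; exact (proj1 topK V hV (a, b) h). Qed.

Lemma open_mull (V : K -> Prop) (k : K) :
  is_open t V -> is_open t (fun x => V (gmul K k x)).
Proof.
  intros hV; apply open_of_nbhd; intros x hx.
  destruct (open_mul V k x hV hx) as [A [B [_ [hB [Ak [Bx h]]]]]].
  exists B; repeat split; auto.
Qed.

Lemma open_mulr (V : K -> Prop) (k : K) :
  is_open t V -> is_open t (fun x => V (gmul K x k)).
Proof.
  intros hV; apply open_of_nbhd; intros x hx.
  destruct (open_mul V x k hV hx) as [A [B [hA [_ [Ax [Bk h]]]]]].
  exists A; repeat split; auto.
Qed.

Lemma open_inv (V : K -> Prop) : is_open t V -> is_open t (fun x => V (ginv K x)).
Proof. apply (proj2 topK). Qed.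

(** Let [A] times [N] lie in [U], with [N] a neighbourhood of the identity. Then [B], the set of [y]
    whose translate [y N] leaves [U], is open, misses [A] and contains the complement of [U]. *)
Lemma regular (U : K -> Prop) (x : K) : is_open t U -> U x ->
  exists A B, is_open t A /\ is_open t B /\ A x /\
    (forall y, ~ (A y /\ B y)) /\ forall y, U y \/ B y.
Proof.
  intros hU Ux; assert (h1 : U (gmul K x (gone K))) by (grp; auto).
  destruct (open_mul U x (gone K) hU h1) as [A [N [hA [hN [Ax [N1 h]]]]]].
  exists A, (fun y => exists z, ~ U z /\ N (gmul K (ginv K y) z)).
  repeat split; auto.
  - apply open_of_nbhd; intros y [z [Uz Nz]].
    exists (fun w => N (gmul K (ginv K w) z)); repeat split; auto.
    + apply (open_inv (fun w => N (gmul K w z))), open_mulr, hN.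
    + intros w Nw; exists z; auto.
  - intros y [Ay [z [Uz Nz]]]; apply Uz.
    rewrite <- (gcancel_Vr K y z); auto.
  - intros y; destruct (classic (U y)) as [|no]; [left; auto|right].
    exists y; split; auto; rewrite gmul_Vl; auto.
Qed.

(** Disjointness of the closures, phrased with neighbourhoods so that no closure operator enters. *)
Definition apart_closures (U V : K -> Prop) : Prop :=
  forall y, exists O, is_open t O /\ O y /\
    ((forall z, ~ (O z /\ U z)) \/ (forall z, ~ (O z /\ V z))).

Lemma apart_closures_sym U V : apart_closures U V -> apart_closures V U.
Proof. intros h y; destruct (h y) as [O [h1 [h2 h3]]]; exists O; tauto. Qed.

(** Regularity shrinks [O] to an [A] whose closure stays in [O]: points of [O] have a neighbourhood
    missing [V], and all other points have one missing [A]. *)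
Lemma apart_closures_grow (U V O : K -> Prop) (x : K) :
  apart_closures U V -> is_open t O -> O x -> (forall z, ~ (O z /\ V z)) ->
  exists A, is_open t A /\ A x /\ apart_closures (fun z => U z \/ A z) V.
Proof.
  intros hUV hO Ox dis; destruct (regular O x hO Ox) as [A [B [hA [hB [Ax [h1 h2]]]]]].
  exists A; repeat split; auto; intros y; destruct (h2 y) as [Oy|By].
  - exists O; auto.
  - destruct (hUV y) as [P [hP [Py [d|d]]]].
    + exists (fun z => P z /\ B z); split; [apply open_inter; auto|].
      split; auto; left; intros z [[Pz Bz] [Uz|Az]]; [apply (d z)|apply (h1 z)]; auto.
    + exists P; auto.
Qed.

Definition open_pair (p : (K -> Prop) * (K -> Prop)) : Prop :=
  is_open t (fst p) /\ is_open t (snd p) /\ apart_closures (fst p) (snd p).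

Lemma open_or (U V : K -> Prop) :
  is_open t U -> is_open t V -> is_open t (fun z => U z \/ V z).
Proof.
  intros hU hV; apply open_of_nbhd; intros x [h|h];
    [exists U | exists V]; auto.
Qed.

(** Some neighbourhood of [x] misses one of the two sets, so [x] can be absorbed into the other
    without the closures meeting. *)
Lemma open_pair_cover (p : (K -> Prop) * (K -> Prop)) (x : K) : open_pair p ->
  exists q, open_pair q /\ (forall z, fst p z -> fst q z) /\
    (forall z, snd p z -> snd q z) /\ (fst q x \/ snd q x).
Proof.
  destruct p as [U V]; intros [hU [hV hUV]]; simpl in *.
  destruct (hUV x) as [O [hO [Ox [d|d]]]].
  - destruct (apart_closures_grow V U O x (apart_closures_sym _ _ hUV) hO Ox d)
      as [A [hA [Ax h]]].
    exists (U, fun z => V z \/ A z); repeat split; simpl; auto using open_or.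
    apply apart_closures_sym, h.
  - destruct (apart_closures_grow U V O x hUV hO Ox d) as [A [hA [Ax h]]].
    exists (fun z => U z \/ A z, V); repeat split; simpl; auto using open_or.
Qed.

(** Growing the empty set around [x] upgrades the Hausdorff separation to one with disjoint
    closures. *)
Lemma open_pair_init (x y : K) : hausdorff t -> x <> y ->
  exists p, open_pair p /\ fst p x /\ snd p y.
Proof.
  intros hd ne; destruct (hd x y ne) as [U [V [hU [hV [Ux [Vy d]]]]]].
  assert (h0 : apart_closures (fun _ => False) V).
  { intros z; exists (fun _ => True); split; [apply open_full|].
    split; auto; left; tauto. }
  destruct (apart_closures_grow _ V U x h0 hU Ux d) as [A [hA [Ax hAV]]].
  exists (A, V); repeat split; simpl; auto.
  intros z; destruct (hAV z) as [O [h1 [h2 [h3|h3]]]]; exists O; split; auto;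
    split; auto; left; intros w [Ow Aw]; apply (h3 w); auto.
Qed.

(* A countable subspace of a regular space is zero-dimensional. *)
Lemma clopen_partition (X : Type) (f : X -> K) (x y : X) :
  hausdorff t -> countable X -> f x <> f y ->
  exists U V : K -> Prop, is_open t U /\ is_open t V /\ U (f x) /\ V (f y) /\
    (forall k, ~ (U k /\ V k)) /\ forall z, U (f z) \/ V (f z).
Proof.
  intros hd [code code_inj] ne; destruct (open_pair_init _ _ hd ne) as [p0 [h0 [hx hy]]].
  (* The points of [X] are absorbed one at a time in the order of [code]; the unions of the two
     increasing sequences form the partition. *)
  destruct (dependent_choice (fun _ => open_pair)
    (fun n p q => (forall k, fst p k -> fst q k) /\ (forall k, snd p k -> snd q k) /\
       forall z, code z = n -> fst q (f z) \/ snd q (f z)) p0 h0) as [s [e hs]].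
  { intros n p hp; destruct (classic (exists z, code z = n)) as [[z hz]|no].
    - destruct (open_pair_cover p (f z) hp) as [q [h1 [h2 [h3 h4]]]].
      exists q; split; [exact h1|]; split; auto; split; auto; intros z' hz'.
      replace z' with z by (apply code_inj; congruence); auto.
    - exists p; split; [exact hp|]; split; auto; split; auto.
      intros z hz; exfalso; apply no; exists z; auto. }
  assert (mono : forall m n, m <= n -> (forall k, fst (s m) k -> fst (s n) k) /\
                                       (forall k, snd (s m) k -> snd (s n) k)).
  { intros m n h; induction h as [|n h [IH1 IH2]]; auto.
    destruct (hs n) as [_ [h1 [h2 _]]]; auto. }
  exists (fun k => exists n, fst (s n) k), (fun k => exists n, snd (s n) k).
  split; [|split; [|split; [|split; [|split]]]].
  - apply open_of_nbhd; intros k [n hk]; exists (fst (s n)).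
    split; [apply (proj1 (hs n))|]; split; auto; intros; exists n; auto.
  - apply open_of_nbhd; intros k [n hk]; exists (snd (s n)).
    split; [apply (proj1 (hs n))|]; split; auto; intros; exists n; auto.
  - exists 0; rewrite e; auto.
  - exists 0; rewrite e; auto.
  - intros k [[n hn] [m hm]].
    destruct (proj2 (proj2 (proj1 (hs (n + m)))) k) as [O [_ [Ok [d|d]]]];
      apply (d k); split; auto.
    + apply (mono n (n + m)); auto; lia.
    + apply (mono m (n + m)); auto; lia.
  - intros z; destruct (hs (code z)) as [_ [_ [_ h]]].
    destruct (h z eq_refl) as [h'|h']; [left|right]; exists (S (code z)); auto.
Qed.

(** Finitely many right translates of a small [P] cover [K]. Each one that meets the image of [H]
    contributes to [T] the inverse of an element of [H] lying in it, and quotients of two points of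
    one translate lie in [N]. *)
Lemma totally_bounded (H : Group) (f : H -> K) (N : K -> Prop) :
  compact t -> is_group_hom H K f -> is_open t N -> N (gone K) ->
  exists T : list H, forall h, exists u, In u T /\ N (f (gmul H h u)).
Proof.
  intros cpt hom hN N1.
  assert (f1 : f (gone H) = gone K).
  { apply (gmul_cancel_l K (f (gone H))); rewrite <- hom; grp. }
  assert (fV : forall h, f (ginv H h) = ginv K (f h)).
  { intros h; apply (gmul_cancel_l K (f h)); rewrite <- hom; grp; exact f1. }
  assert (h1 : N (gmul K (gone K) (gone K))) by (grp; auto).
  destruct (open_mul N _ _ hN h1) as [A [B [hA [hB [A1 [B1 hAB]]]]]].
  pose (P := fun k => A k /\ B (ginv K k)).
  assert (hP : is_open t P) by (apply open_inter; auto; apply open_inv, hB).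
  destruct (cpt (fun U => exists k, U = fun x => P (gmul K x k))) as [l [hl1 hl2]].
  - intros U [k ->]; apply open_mulr, hP.
  - intros x; exists (fun y => P (gmul K y (ginv K x))); split; [eauto|].
    rewrite gmul_Vr; split; auto; rewrite ginv_1; auto.
  - assert (rep : exists T : list H, forall U h, In U l -> U (f h) ->
        exists u, In u T /\ U (f (ginv H u))).
    { clear hl1 hl2; induction l as [|U l [T hT]]; [exists nil; intros ? ? []|].
      destruct (classic (exists h, U (f h))) as [[h0 hh]|no].
      - exists (ginv H h0 :: T); intros V h [<-|hV] Vh.
        + exists (ginv H h0); split; [left; auto|]; grp; auto.
        + destruct (hT V h hV Vh) as [u [h2 h3]]; exists u; split; [right|]; auto.
      - exists T; intros V h [<-|hV] Vh; [exfalso; eauto|eauto]. }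
    destruct rep as [T hT]; exists T; intros h.
    destruct (hl2 (f h)) as [U [hU Uh]].
    destruct (hT U h hU Uh) as [u [hu Uu]]; exists u; split; auto.
    destruct (hl1 U hU) as [k ->]; destruct Uh as [Uh _], Uu as [_ Uu].
    replace (f (gmul H h u)) with
      (gmul K (gmul K (f h) k) (ginv K (gmul K (f (ginv H u)) k))); auto.
    rewrite hom, fV; grp.
Qed.

End TopGroup.

(** For [i] other than the identity, [a i] is the indicator of a clopen subset of [H] separating the
    identity from [i]. Finitely many conditions [a i (e y x) = a i (e x)] hold for [y] near the
    identity, and total boundedness brings every [h] there by some [u] in [T]. *)
Lemma almost_periodic_separation (H : Group) :
  countable H -> maximally_almost_periodic H ->
  exists a : H -> H -> bool,
    (forall h, h <> gone H -> a h h <> a h (gone H)) /\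
    forall L : list (H * H * H), exists T : list H, forall h, exists u, In u T /\
      forall i e x, In (i, e, x) L ->
        a i (gmul H e (gmul H (gmul H h u) x)) = a i (gmul H e x).
Proof.
  intros cH [K [t [f [[topK [cpt hd]] [hom inj]]]]].
  assert (sep : forall h : H, exists U V : K -> Prop, is_open t U /\ is_open t V /\
    (h <> gone H -> U (f (gone H)) /\ V (f h)) /\
    (forall k, ~ (U k /\ V k)) /\ forall z, U (f z) \/ V (f z)).
  { intros h; destruct (classic (h = gone H)) as [e|ne].
    - exists (fun _ => True), (fun _ => False); repeat split; try tauto.
      + apply open_full.
      + apply open_of_nbhd; intros _ [].
    - destruct (clopen_partition K t topK H f (gone H) h hd cH) as [U [V hUV]].
      + intros e; apply ne; symmetry; auto.
      + exists U, V; tauto. }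
  apply choice in sep as [U sep]; apply choice in sep as [V sep].
  pose (a := fun i h =>
    if excluded_middle_informative (U i (f h)) then true else false).
  (* [a i] is continuous for the topology that [H] inherits from the compact group. *)
  assert (aE : forall i h, exists O, is_open t O /\ O (f h) /\
             forall x, O (f x) -> a i x = a i h).
  { intros i h; destruct (sep i) as [hU [hV [_ [dis cov]]]]; unfold a.
    destruct (excluded_middle_informative (U i (f h))) as [y|n].
    - exists (U i); repeat split; auto; intros x hx.
      destruct (excluded_middle_informative (U i (f x))); tauto.
    - exists (V i); repeat split; auto; [destruct (cov h); tauto|].
      intros x hx; destruct (excluded_middle_informative (U i (f x))); auto.
      exfalso; apply (dis (f x)); auto. }
  exists a; split.
  - intros h ne; destruct (sep h) as [_ [_ [h1 [dis _]]]].
    destruct (h1 ne) as [h2 h3]; unfold a.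
    destruct (excluded_middle_informative (U h (f h)));
      destruct (excluded_middle_informative (U h (f (gone H)))); try easy.
    exfalso; apply (dis (f h)); auto.
  - intros L.
    assert (hN : exists N, is_open t N /\ N (gone K) /\ forall i e x y, In (i, e, x) L ->
        N (f y) -> a i (gmul H e (gmul H y x)) = a i (gmul H e x)).
    { induction L as [|[[i e] x] L [N [hN [N1 h]]]].
      - exists (fun _ => True); split; [apply open_full|]; split; auto; intros ? ? ? ? [].
      - destruct (aE i (gmul H e x)) as [O [hO [Oe hOa]]].
        exists (fun k => N k /\ O (gmul K (f e) (gmul K k (f x)))); split; [|split].
        + apply open_inter; auto.
          apply (open_mulr K t topK (fun z => O (gmul K (f e) z))).
          apply open_mull; auto.
        + split; auto; grp; rewrite <- hom; auto.
        + intros i' e' x' y [E|hin] [Ny Oy]; [|apply h; auto].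
          injection E as <- <- <-; apply hOa; rewrite !hom; auto. }
    destruct hN as [N [hN [N1 h]]].
    destruct (totally_bounded K t topK H f N cpt hom hN N1) as [T hT].
    exists T; intros g; destruct (hT g) as [u [hu Nu]]; exists u; split; auto.
Qed.

(** * Strongly irreducible families *)

Section Greedy.
Context (G : Group) (code : G -> nat) (code_inj : forall x y, code x = code y -> x = y).

(** Recursion along the enumeration of [G]: [F n] is the partial function already defined on the
    elements of code below [n]. *)
Lemma greedy {X : Type} (Phi : G -> (G -> option X) -> X) :
  exists f : G -> X, forall k,
    f k = Phi k (fun j => if code j <? code k then Some (f j) else None).
Proof.
  pose (F := fix F n : G -> option X := match n with
    | 0 => fun _ => None
    | S n => fun j => if code j =? n then Some (Phi j (F n)) else F n j end).
  pose (f := fun j => Phi j (F (code j))).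
  assert (e : forall n, F n = fun j => if code j <? n then Some (f j) else None).
  { intros n; induction n as [|n IH]; extensionality j.
    - reflexivity.
    - simpl F; destruct (Nat.eqb_spec (code j) n) as [q|ne].
      + rewrite (proj2 (Nat.ltb_lt (code j) (S n))) by lia.
        subst n; reflexivity.
      + rewrite IH; destruct (Nat.ltb_spec (code j) n), (Nat.ltb_spec (code j) (S n));
          auto; lia. }
  exists f; intros k; rewrite <- e; reflexivity.
Qed.

Lemma avoid_two (o1 o2 : option (bool * bool)) :
  exists x, Some x <> o1 /\ Some x <> o2.
Proof.
  destruct o1 as [[[] []]|], o2 as [[[] []]|];
  solve [ exists (true, true); split; discriminate
        | exists (true, false); split; discriminate
        | exists (false, true); split; discriminate
        | exists (false, false); split; discriminate ].
Qed.

(** In the graph joining [k] to [g k], a vertex has at most two neighbours, [g k] and [g^-1 k], so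
    four colours let the vertices outside [Fd] be coloured greedily. *)
Lemma extend_coloring (g : G) (Fd : G -> Prop) (c0 : G -> bool * bool) :
  g <> gone G ->
  (forall k, Fd k -> Fd (gmul G g k) -> c0 k <> c0 (gmul G g k)) ->
  exists c, (forall k, Fd k -> c k = c0 k) /\ forall k, c k <> c (gmul G g k).
Proof.
  intros hg h0.
  (* The colour visible so far: vertices of [Fd] count as coloured from the start, the others only
     once enumerated. *)
  pose (v := fun (p : G -> option (bool * bool)) j =>
    if excluded_middle_informative (Fd j) then Some (c0 j) else p j).
  pose (pick := fun o1 o2 => proj1_sig
    (constructive_indefinite_description _ (avoid_two o1 o2))).
  destruct (greedy (fun k p =>
    if excluded_middle_informative (Fd k) then c0 k
    else pick (v p (gmul G g k)) (v p (gmul G (ginv G g) k)))) as [c hc].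
  assert (pickP : forall o1 o2, Some (pick o1 o2) <> o1 /\ Some (pick o1 o2) <> o2)
    by (intros; apply proj2_sig).
  assert (cF : forall k, Fd k -> c k = c0 k).
  { intros k hk; rewrite hc; destruct (excluded_middle_informative (Fd k)); tauto. }
  exists c; split; auto.
  assert (cN : forall k j, ~ Fd k -> Fd j \/ code j < code k ->
      j = gmul G g k \/ j = gmul G (ginv G g) k -> c k <> c j).
  { intros k j nk hj hjk E.
    rewrite (hc k) in E; destruct (excluded_middle_informative (Fd k)) as [|_]; [tauto|].
    set (p := fun j => if code j <? code k then Some (c j) else None) in E.
    assert (vj : v p j = Some (c j)).
    { unfold v; destruct (excluded_middle_informative (Fd j)) as [y|n].
      - rewrite cF; auto.
      - unfold p; rewrite (proj2 (Nat.ltb_lt _ _)); [auto|tauto]. }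
    destruct (pickP (v p (gmul G g k)) (v p (gmul G (ginv G g) k))) as [p1 p2].
    destruct hjk as [q|q]; rewrite <- q in *; [apply p1|apply p2]; rewrite E, vj; auto. }
  intros k; set (j := gmul G g k).
  assert (kj : k = gmul G (ginv G g) j) by (unfold j; grp).
  assert (ne : code j <> code k).
  { intros q; apply hg, (gmul_cancel_r G k); rewrite gmul_1l; apply code_inj, q. }
  destruct (classic (Fd k)) as [Fk|Fk].
  - destruct (classic (Fd j)) as [Fj|Fj].
    + rewrite !cF; auto.
    + apply not_eq_sym, cN; auto.
  - destruct (classic (Fd j \/ code j < code k)) as [h|h].
    + apply cN; auto.
    + apply not_eq_sym, cN; auto; right; lia.
Qed.

(** The conclusion is an equation rather than a contradiction because [D] may contain the
    identity. *)
Definition independent (D : list G) (C : G -> Prop) : Prop :=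
  forall c d, In d D -> C c -> C (gmul G d c) -> gmul G d c = c.

Definition maximal (D : list G) (C : G -> Prop) : Prop :=
  forall k, exists d, In d D /\ C (gmul G d k).

(** Greedy choice: [k] is added when none of its [D]-translates lies in [Fd] or was chosen earlier.
    Symmetry of [D] settles pairs enumerated in either order, and an element left out has a
    [D]-translate in [C]. *)
Lemma extend_independent (D : list G) (Fd : G -> Prop) :
  In (gone G) D -> (forall d, In d D -> In (ginv G d) D) -> independent D Fd ->
  exists C, (forall k, Fd k -> C k) /\ independent D C /\ maximal D C.
Proof.
  intros D1 Dinv hF.
  destruct (greedy (X := Prop) (fun k p => Fd k \/ forall d, In d D ->
    ~ Fd (gmul G d k) /\ match p (gmul G d k) with Some P => ~ P | None => True end))
    as [C hC].
  assert (CF : forall k, Fd k -> C k) by (intros k hk; rewrite hC; auto).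
  assert (CN : forall k d, C k -> ~ Fd k -> In d D ->
    ~ Fd (gmul G d k) /\ (code (gmul G d k) < code k -> ~ C (gmul G d k))).
  { intros k d hk nk hd; rewrite hC in hk; destruct hk as [|hk]; [tauto|].
    destruct (hk d hd) as [h1 h2]; split; auto; intros lt.
    apply Nat.ltb_lt in lt; rewrite lt in h2; auto. }
  exists C; split; auto; split.
  - intros c d hd hc hdc; set (c' := gmul G d c) in *.
    assert (cc' : c = gmul G (ginv G d) c') by (unfold c'; grp).
    pose proof (Dinv d hd) as hd'.
    destruct (classic (Fd c)) as [Fc|Fc], (classic (Fd c')) as [Fc'|Fc'].
    + apply hF; auto.
    + destruct (CN c' _ hdc Fc' hd') as [h _]; rewrite <- cc' in h; tauto.
    + destruct (CN c _ hc Fc hd) as [h _]; tauto.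
    + destruct (CN c _ hc Fc hd) as [_ h1], (CN c' _ hdc Fc' hd') as [_ h2].
      rewrite <- cc' in h2; fold c' in h1.
      destruct (lt_eq_lt_dec (code c) (code c')) as [[lt|e]|lt]; try tauto.
      symmetry; apply code_inj; auto.
  - intros k; apply NNPP; intros no.
    assert (nC : ~ C k) by (intros hk; apply no; exists (gone G); rewrite gmul_1l; auto).
    apply nC; rewrite hC; right; intros d hd; split.
    + intros h; apply no; exists d; auto.
    + destruct (code (gmul G d k) <? code k); auto; intros h; apply no; exists d; auto.
Qed.

(** Induction on [T]: as [G] is infinite, a new position exists outside the finitely many translates
    of the earlier ones by [D] and its inverses. *)
Lemma spread {X : Type} (T : list X) (D : list G) : infinite G ->
  exists delta : X -> G, forall s t d, In s T -> In t T -> s <> t -> In d D ->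
    delta t <> gmul G d (delta s).
Proof.
  intros inf; induction T as [|u T [delta hd]].
  - exists (fun _ => gone G); intros ? ? ? [].
  - destruct (classic (In u T)) as [hu|hu].
    + exists delta; intros s t d hs ht; apply hd.
      * destruct hs as [<-|]; auto.
      * destruct ht as [<-|]; auto.
    + destruct (inf (lmul G (D ++ linv G D) (map delta T))) as [x hx].
      exists (fun s => if excluded_middle_informative (s = u) then x else delta s).
      intros s t d hs ht ne hD.
      destruct (excluded_middle_informative (s = u)) as [es|es];
      destruct (excluded_middle_informative (t = u)) as [et|et].
      * congruence.
      * intros E; apply hx.
        replace x with (gmul G (ginv G d) (delta t)) by (rewrite E; grp).
        apply in_lmul; [apply in_or_app; right; apply in_linv; auto|].
        apply in_map; destruct ht; congruence.
      * intros E; apply hx; rewrite E; apply in_lmul; [apply in_or_app; auto|].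
        apply in_map; destruct hs; congruence.
      * apply hd; auto; [destruct hs|destruct ht]; congruence.
Qed.
End Greedy.

(** * Configurations, stages and their refinement *)

Definition sym (H : Group) : Type := ((nat -> bool * bool) * H)%type.
Definition sim (H : Group) (n : nat) (x y : sym H) : Prop :=
  snd x = snd y /\ forall i, i < n -> fst x i = fst y i.
Definition shift (G H : Group) (g : G) (z : G -> sym H) : G -> sym H :=
  fun k => z (gmul G k g).
Definition translate (G H : Group) (h : H) (z : G -> sym H) : G -> sym H :=
  fun k => (fst (z k), gmul H h (snd (z k))).

(* Strong irreducibility: pieces of points of [Z] carried by sets that are pairwise
   [D]-apart can be glued into one point of [Z]. *)
Definition gluing {G : Group} {X : Type} (D : list G) (Z : (G -> X) -> Prop) : Prop :=
  forall (J : Type) (A : J -> G -> Prop) (zs : J -> G -> X),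
    (forall j, Z (zs j)) ->
    (forall i j k d, i <> j -> In d D -> A i k -> ~ A j (gmul G d k)) ->
    exists z, Z z /\ forall j k, A j k -> z k = zs j k.

(** [stage_fresh] leaves the coordinates from [n] on unconstrained, so that coordinate [n] is
    available for a new colouring. *)
Record stage (G H : Group) (n : nat) (Z : (G -> sym H) -> Prop) : Prop := {
  stage_shift : forall g z, Z z -> Z (shift G H g z);
  stage_translate : forall h z, Z z -> Z (translate G H h z);
  stage_fresh : forall z z', (forall k, sim H n (z k) (z' k)) -> Z z -> Z z';
  stage_gluing : exists D, In (gone G) D /\ gluing D Z
}.

Section Stages.
Context (G H : Group) (code : G -> nat)
  (code_inj : forall x y, code x = code y -> x = y) (infG : infinite G).
Notation cfg := (G -> sym H).
Notation "x * y" := (gmul G x y).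
Notation "x ^-1" := (ginv G x) (at level 3, left associativity, format "x ^-1").
Notation sh := (shift G H).

Lemma shift_shift c g (z : cfg) : sh c (sh g z) = sh (c * g) z.
Proof. extensionality k; unfold shift; grp. Qed.

Lemma sim_refl n (x : sym H) : sim H n x x.
Proof. split; auto. Qed.

(** Maximality of [C] makes the occurrences of [Q] syndetic, and its independence leaves the room
    needed for gluing. *)
Definition marked (D : list G) (Q Z : cfg -> Prop) (z : cfg) : Prop :=
  Z z /\ exists C, independent G D C /\ maximal G D C /\ forall c, C c -> Q (sh c z).

(** Markers near each [A j] are inherited from [zs j]; the remaining ones are filled with [q0]. By
    the choice of [D1], windows about distinct markers are [D]-apart, so gluing in [Z] realises the
    result. *)
Lemma marked_gluing (D W : list G) (Q Z : cfg -> Prop) (q0 : cfg) :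
  (forall g z, Z z -> Z (sh g z)) -> In (gone G) D -> gluing D Z ->
  (forall z, Q z -> Z z) -> Q q0 ->
  (forall z q, Z z -> Q q -> (forall w, In w W -> z w = q w) -> Q z) ->
  exists D1, In (gone G) D1 /\
    exists D2, In (gone G) D2 /\ gluing D2 (marked D1 Q Z).
Proof.
  intros Zsh D_1 glZ QZ Qq QW.
  pose (D0 := lmul G (linv G W) (lmul G D W)).
  pose (D1 := gone G :: D0 ++ linv G D0).
  assert (D1_1 : In (gone G) D1) by (left; auto).
  assert (D1inv : forall d, In d D1 -> In d^-1 D1).
  { intros d [<-|h]; [left; symmetry; apply ginv_1|right].
    apply in_app_or in h as [h|h]; apply in_or_app.
    - right; apply in_linv, h.
    - left; apply linv_in, h. }
  assert (D1W : forall d w w', In d D -> In w W -> In w' W -> In (w'^-1 * (d * w)) D1).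
  { intros; right; apply in_or_app; left; apply in_lmul; [apply in_linv; auto|].
    apply in_lmul; auto. }
  (* [E] times [A j] contains every centre whose window comes [D]-close to [A j]. [M1] allows one
     more [D1]-step, enough to meet a marker of [zs j], and [M2] also covers the windows about kept
     markers. *)
  pose (E := lmul G (linv G W) (D ++ linv G D)).
  pose (M1 := lmul G D1 E).
  pose (M2 := gone G :: lmul G W M1).
  (* The first half keeps the pieces of different [j] [D]-apart, the second keeps their markers
     [D1]-apart. *)
  pose (D2 := lmul G (linv G M2) (lmul G D M2) ++ lmul G (linv G M1) (lmul G D1 M1)).
  exists D1; split; auto; exists D2; split.
  { apply in_or_app; left.
    replace (gone G) with ((gone G)^-1 * (gone G * gone G)) by grp.
    apply in_lmul; [apply in_linv; left; auto|apply in_lmul; auto; left; auto]. }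
  intros J A zs hzs hA.
  assert (hC : forall j, exists C, independent G D1 C /\ maximal G D1 C /\
             forall c, C c -> Q (sh c (zs j))) by (intros j; apply (hzs j)).
  apply choice in hC as [C hC].
  (* Near [A j] the markers of [zs j] are kept; all others are chosen afresh. *)
  pose (K := fun j c => C j c /\ exists m a, In m M1 /\ A j a /\ c = m * a).
  assert (sameK : forall i j c d, In d D1 -> K i c -> K j (d * c) -> i = j).
  { intros i j c d hd [_ [m [a [hm [ha ->]]]]] [_ [m' [a' [hm' [ha' e]]]]].
    apply NNPP; intros ne.
    apply (hA i j a (m'^-1 * (d * m)) ne); auto.
    - apply in_or_app; right; apply in_lmul; [apply in_linv; auto|apply in_lmul; auto].
    - replace (m'^-1 * (d * m) * a) with a'; auto.
      apply (gmul_cancel_l G m'); rewrite <- e; grp. }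
  destruct (extend_independent G code code_inj D1 (fun c => exists j, K j c))
    as [C' [C'K [C'ind C'max]]]; auto.
  { intros c d hd [i hi] [j hj]; pose proof (sameK i j c d hd hi hj) as e; subst j.
    destruct (hC i) as [ind _]; apply ind; [auto|apply hi|apply hj]. }
  pose (New := fun c => C' c /\ ~ exists j, K j c).
  (* Such a [c] would have a kept marker among its [D1]-translates and, by independence of [C'],
     would coincide with it. *)
  assert (far : forall c j e a, New c -> In e E -> A j a -> c <> e * a).
  { intros c j e a [hc hn] he ha q; apply hn.
    destruct (hC j) as [_ [mx _]]; destruct (mx c) as [d [hd hdc]].
    assert (Kd : K j (d * c)).
    { split; auto; exists (d * e), a; split; [apply in_lmul; auto|].
      split; auto; rewrite q; grp. }
    exists j; rewrite <- (C'ind c d hd hc); auto; apply C'K; exists j; auto. }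
  pose (Piece := fun (s : J + G) k => match s with
    | inl j => A j k \/ exists c w, K j c /\ In w W /\ k = w * c
    | inr c => New c /\ exists w, In w W /\ k = w * c end).
  (* Shifting by the inverse of [c] centres [q0] at [c]. *)
  pose (zp := fun s : J + G => match s with
    | inl j => zs j | inr c => sh c^-1 q0 end).
  assert (core : forall j k, Piece (inl j) k ->
            exists m a, In m M2 /\ A j a /\ k = m * a).
  { intros j k [h|[c [w [[_ [m [a [hm [ha ->]]]]] [hw ->]]]]].
    - exists (gone G), k; split; [left|]; auto; split; auto; grp.
    - exists (w * m), a; split; [right; apply in_lmul; auto|].
      split; auto; grp. }
  assert (marks : forall c c' d w w', C' c -> C' c' -> In d D -> In w W -> In w' W ->
            w' * c' = d * (w * c) -> c' = c).
  { intros c c' d w w' hc hc' hd hw hw' e.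
    assert (ec : c' = w'^-1 * (d * w) * c).
    { apply (gmul_cancel_l G w'); rewrite e; grp. }
    rewrite ec; apply C'ind; auto; rewrite <- ec; auto. }
  destruct (glZ (J + G)%type Piece zp) as [z [Zz hz]].
  - intros [j|c]; simpl; [apply hzs|apply Zsh, QZ, Qq].
  - intros [i|c] [j|c'] k d ne hd h1 h2.
    + destruct (core i k h1) as [m [a [hm [ha ->]]]].
      destruct (core j _ h2) as [m' [a' [hm' [ha' e]]]].
      apply (hA i j a (m'^-1 * (d * m))); auto; [congruence| |].
      * apply in_or_app; left; apply in_lmul; [apply in_linv; auto|apply in_lmul; auto].
      * replace (m'^-1 * (d * m) * a) with a'; auto.
        apply (gmul_cancel_l G m'); rewrite <- e; grp.
    + destruct h2 as [hn [w' [hw' e]]]; destruct h1 as [h1|[c [w [hc [hw ->]]]]].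
      * apply (far c' i (w'^-1 * d) k hn); auto.
        -- apply in_lmul; [apply in_linv; auto|apply in_or_app; auto].
        -- apply (gmul_cancel_l G w'); rewrite <- e; grp.
      * assert (q : c' = c) by (apply (marks c c' d w w'); auto;
          [apply C'K; exists i; auto | apply hn]).
        subst c'; apply (proj2 hn); exists i; auto.
    + destruct h1 as [hn [w [hw ->]]]; destruct h2 as [h2|[c' [w' [hc [hw' e]]]]].
      * apply (far c j (w^-1 * d^-1) (d * (w * c)) hn); auto; [|grp].
        apply in_lmul; [apply in_linv; auto|apply in_or_app; right; apply in_linv; auto].
      * assert (q : c' = c) by (apply (marks c c' d w w'); auto;
          [apply hn | apply C'K; exists j; auto]).
        subst c'; apply (proj2 hn); exists j; auto.
    + destruct h1 as [hn [w [hw ->]]]; destruct h2 as [hn' [w' [hw' e]]].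
      apply ne; f_equal; symmetry; apply (marks c c' d w w'); auto;
        [apply hn|apply hn'].
  - exists z; split; [split; auto; exists C'; split; auto; split; auto|].
    + intros c hc; destruct (classic (exists j, K j c)) as [[j hj]|hn].
      * apply (QW _ (sh c (zs j))); [apply Zsh; auto|apply (hC j), hj|].
        intros w hw; apply (hz (inl j)); right; exists c, w; auto.
      * apply (QW _ q0); [apply Zsh; auto|auto|].
        intros w hw; unfold shift at 1; rewrite (hz (inr c)).
        -- simpl; unfold shift; grp.
        -- split; [split; auto|exists w; auto].
    + intros j k hk; apply (hz (inl j)); left; auto.
Qed.

Lemma marked_shift (D : list G) (Q Z : cfg -> Prop) :
  (forall g z, Z z -> Z (sh g z)) ->
  forall g z, marked D Q Z z -> marked D Q Z (sh g z).
Proof.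
  intros Zsh g z [Zz [C [ind [mx hC]]]]; split; auto.
  exists (fun c => C (c * g)); split; [|split].
  - intros c d hd hc hdc; apply (gmul_cancel_r G g).
    rewrite <- gmul_assoc; apply ind; auto; rewrite gmul_assoc; auto.
  - intros k; destruct (mx (k * g)) as [d [hd h]]; exists d; split; auto.
    rewrite <- gmul_assoc; auto.
  - intros c hc; rewrite shift_shift; auto.
Qed.

(** [Q] asks for the patterns [h t z1], for all [t] in [T], at offsets [delta t] far enough apart
    for gluing. Since [h] is arbitrary, [Q] is preserved by [translate], hence so is the new
    stage. *)
Lemma marker_step (n : nat) (Z : cfg -> Prop) (W : list G) (z1 : cfg) (T : list H) :
  stage G H n Z -> Z z1 ->
  exists Z' S, stage G H n Z' /\ (forall z, Z' z -> Z z) /\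
    forall z, Z' z -> exists s h, In s S /\ forall t, In t T ->
      exists r, In r S /\ forall w, In w W ->
        sim H n (z (w * (r * s))) (translate G H (gmul H h t) z1 w).
Proof.
  intros [Zsh Ztr Zfr [D [D_1 glZ]]] Zz1.
  destruct (spread G T (lmul G (linv G W) (lmul G D W)) infG) as [delta hdelta].
  pose (Q := fun z => Z z /\ exists h, forall t w, In t T -> In w W ->
    sim H n (z (w * delta t)) (translate G H (gmul H h t) z1 w)).
  (* With [h] the identity, gluing the translates [t z1] at their offsets gives a point of [Q]. *)
  assert (hq0 : exists q0, Q q0).
  { destruct (glZ H (fun t k => In t T /\ exists w, In w W /\ k = w * delta t)
      (fun t => sh (delta t)^-1 (translate G H t z1))) as [q0 [Zq hq]].
    - intros t; auto.
    - intros s t k d ne hd [hs [w [hw ->]]] [ht [w' [hw' e]]].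
      apply (hdelta s t (w'^-1 * (d * w)) hs ht ne).
      + apply in_lmul; [apply in_linv; auto|apply in_lmul; auto].
      + apply (gmul_cancel_l G w'); rewrite <- e; grp.
    - exists q0; split; auto; exists (gone H); intros t w ht hw.
      rewrite (hq t) by (split; auto; exists w; auto).
      unfold shift; rewrite gmul_1l; grp; apply sim_refl. }
  destruct hq0 as [q0 hq0].
  destruct (marked_gluing D (lmul G W (map delta T)) Q Z q0)
    as [D1 [D1_1 [D2 [D2_1 glue]]]]; auto.
  - intros z [Zz _]; auto.
  - intros z q Zz [_ [h hh]] e; split; auto; exists h; intros t w ht hw.
    rewrite e; auto; apply in_lmul; auto; apply in_map; auto.
  - exists (marked D1 Q Z), (D1 ++ map delta T); split; [|split].
    + split.
      * apply marked_shift; auto.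
      * intros h' z [Zz [C [ind [mx hC]]]]; split; auto; exists C; split; auto.
        split; auto; intros c hc; destruct (hC c hc) as [h1 [h h2]].
        split; [apply (Ztr h' _ h1)|]; exists (gmul H h' h); intros t w ht hw.
        destruct (h2 t w ht hw) as [h3 h4]; split; simpl in *; auto.
        unfold shift, translate in *; simpl in *; rewrite h3, !gmul_assoc; auto.
      * intros z z' e [Zz [C [ind [mx hC]]]]; split; [eapply Zfr; eauto|].
        exists C; split; auto; split; auto; intros c hc.
        destruct (hC c hc) as [h1 [h h2]]; split.
        -- eapply Zfr; [|apply h1]; intros k; apply e.
        -- exists h; intros t w ht hw; destruct (h2 t w ht hw) as [h3 h4].
           destruct (e (w * delta t * c)) as [e1 e2]; unfold shift in *; split.
           ++ rewrite <- e1; auto.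
           ++ intros i hi; rewrite <- e2; auto.
      * exists D2; auto.
    + intros z [Zz _]; auto.
    (* Maximality at the identity yields a marker [s] in [D1]; the offset [r] is [delta t]. *)
    + intros z [Zz [C [ind [mx hC]]]]; destruct (mx (gone G)) as [s [hs Cs]].
      rewrite gmul_1r in Cs; destruct (hC s Cs) as [_ [h hh]].
      exists s, h; split; [apply in_or_app; auto|]; intros t ht.
      exists (delta t); split; [apply in_or_app; right; apply in_map; auto|].
      intros w hw; rewrite gmul_assoc; apply hh; auto.
Qed.

(** Coordinate [n] is still free and can be overwritten by a proper colouring of the graph joining
    [k] to [g k]. Adding [g] to [D] prevents edges between different pieces, so the glued partial
    colouring is proper and extends. *)
Lemma coloring_step (n : nat) (Z : cfg -> Prop) (g : G) :
  stage G H n Z -> g <> gone G ->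
  exists Z', stage G H (S n) Z' /\ (forall z, Z' z -> Z z) /\
    forall z, Z' z -> fst (z (gone G)) n <> fst (z g) n.
Proof.
  intros [Zsh Ztr Zfr [D [D_1 glZ]]] hg.
  exists (fun z => Z z /\ forall k, fst (z k) n <> fst (z (g * k)) n).
  split; [split|split].
  - intros g' z [Zz hz]; split; auto; intros k; unfold shift.
    rewrite <- gmul_assoc; apply hz.
  - intros h z [Zz hz]; split; auto.
  - intros z z' e [Zz hz]; split.
    + apply (Zfr z); auto; intros k; destruct (e k) as [e1 e2]; split; auto.
    + intros k; destruct (e k) as [_ e1], (e (g * k)) as [_ e2].
      rewrite <- e1, <- e2; auto.
  - exists (g :: D); split; [right; auto|]; intros J A zs hzs hA.
    destruct (glZ J A zs) as [z [Zz hz]]; [apply hzs| |].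
    { intros i j k d ne hd; apply hA; auto; right; auto. }
    destruct (extend_coloring G code code_inj g (fun k => exists j, A j k)
      (fun k => fst (z k) n)) as [c [c1 c2]]; auto.
    { intros k [i hi] [j hj]; destruct (classic (i = j)) as [<-|ne].
      - rewrite (hz i k hi), (hz i _ hj); apply hzs.
      - exfalso; apply (hA i j k g ne); auto; left; auto. }
    pose (z' := fun k => (fun i => if Nat.eq_dec i n then c k else fst (z k) i,
                          snd (z k))).
    exists z'; split; [split|].
    + apply (Zfr z); auto; intros k; split; auto; intros i hi; simpl.
      destruct (Nat.eq_dec i n); auto; lia.
    + intros k; simpl; destruct (Nat.eq_dec n n); [apply c2|congruence].
    + intros j k hk; rewrite <- (hz j k hk).
      apply injective_projections; simpl; auto.
      extensionality i; destruct (Nat.eq_dec i n) as [->|]; auto.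
      apply c1; exists j; auto.
  - intros z [Zz _]; auto.
  - intros z [_ hz]; specialize (hz (gone G)); rewrite gmul_1r in hz; exact hz.
Qed.

End Stages.

(** * The flow *)

(** Compactness of a countable product of two-point spaces: [y] lies in the closure of every [B n].
    Values are fixed one code at a time, keeping the partial choice realised in all [B n]. *)
Lemma decreasing_limit {I : Type} (code : I -> nat) (B : nat -> (I -> bool) -> Prop) :
  (forall i j, code i = code j -> i = j) ->
  (forall n b, B (S n) b -> B n b) -> (forall n, exists b, B n b) ->
  exists y, forall n (l : list I), exists b, B n b /\ forall i, In i l -> b i = y i.
Proof.
  intros code_inj decr ne.
  assert (mono : forall m n b, m <= n -> B n b -> B m b).
  { intros m n b h; induction h; auto. }
  pose (P := fun m (y : I -> bool) => forall n, exists b, B n b /\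
    forall i, code i < m -> b i = y i).
  destruct (dependent_choice P (fun m y y' => forall i, code i < m -> y' i = y i)
    (fun _ => false)) as [s [_ hs]].
  - intros n; destruct (ne n) as [b hb]; exists b; split; auto; intros; lia.
  - intros m y hy.
    pose (ext := fun (v : bool) i => if code i =? m then v else y i).
    assert (old : forall v i, code i < m -> ext v i = y i).
    { intros v i hi; unfold ext; destruct (Nat.eqb_spec (code i) m); auto; lia. }
    assert (new : forall v b, (forall i, code i < m -> b i = y i) ->
        (forall i, code i = m -> b i = v) -> forall i, code i < S m -> b i = ext v i).
    { intros v b h1 h2 i hi; unfold ext; destruct (Nat.eqb_spec (code i) m); auto.
      apply h1; lia. }
    destruct (classic (P (S m) (ext true))) as [h|h]; [exists (ext true); auto|].
    exists (ext false); split; auto.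
    (* If [true] fails at level [n0] it fails at all later levels, so a member of [B (n + n0)]
       realises [false], and it also belongs to [B n]. *)
    apply not_all_ex_not in h as [n0 h]; intros n.
    destruct (hy (n + n0)) as [b [hb e]]; exists b; split.
    + apply (mono n (n + n0)); auto; lia.
    + apply new; auto; intros i hi; destruct (b i) eqn:bi; auto; exfalso; apply h.
      exists b; split; [apply (mono n0 (n + n0)); auto; lia|].
      apply new; auto; intros j hj; rewrite (code_inj j i); congruence.
  (* Coordinate [i] no longer changes from step [S (code i)] on. *)
  - exists (fun i => s (S (code i)) i); intros n l.
    destruct (finite_bound code l) as [N hN].
    destruct (proj1 (hs N) n) as [b [hb e]]; exists b; split; auto.
    intros i hi; specialize (hN i hi); rewrite (e i hN); clear - hN hs.
    induction hN as [|N hN IH]; auto; rewrite <- IH; apply (hs N); lia.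
Qed.

Section Flow.
Context (G H : Group) (cG : G -> nat) (cG_inj : forall x y, cG x = cG y -> x = y)
  (infG : infinite G) (cH : countable H) (a : H -> H -> bool)
  (a_per : forall L : list (H * H * H), exists T : list H, forall h, exists u, In u T /\
      forall i e x, In (i, e, x) L ->
        a i (gmul H e (gmul H (gmul H h u) x)) = a i (gmul H e x)).

(** Bit-valued tests on symbols: one bit of a colour, or a clopen test [a i] on the [H]-component
    multiplied on the left by [e]. Thanks to [e], translation by [H] permutes the tests, through
    [twist]. *)
Definition obs : Type := (nat * bool + H * H)%type.

Definition read (o : obs) (x : sym H) : bool :=
  match o with
  | inl (n, b) => if b then fst (fst x n) else snd (fst x n)
  | inr (i, e) => a i (gmul H e (snd x))
  end.

Definition twist (h : H) (o : obs) : obs :=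
  match o with inl c => inl c | inr (i, e) => inr (i, gmul H e h) end.

Definition pattern : Type := list ((obs * G) * bool).

Definition sat (p : pattern) (z : G -> sym H) : Prop :=
  forall o k b, In ((o, k), b) p -> read o (z k) = b.

(** Tests on the [H]-component get depth 0 because [sim] fixes that component at every level. *)
Definition depth (q : (obs * G) * bool) : nat :=
  match fst (fst q) with inl (n, _) => n | inr _ => 0 end.

Definition syndetic (p : pattern) (Z : (G -> sym H) -> Prop) : Prop :=
  exists S, forall z, Z z -> exists s, In s S /\ sat p (shift G H s z).

Lemma stage_S n Z : stage G H n Z -> stage G H (S n) Z.
Proof.
  intros [h1 h2 h3 h4]; split; auto; intros z z' e; apply h3.
  intros k; destruct (e k) as [e1 e2]; split; auto.
Qed.

Lemma stage_top : stage G H 0 (fun _ => True).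
Proof.
  split; auto; exists [gone G]; split; [left; auto|]; intros J A zs _ hA.
  assert (h : forall k, exists x, forall j, A j k -> x = zs j k).
  { intros k; destruct (classic (exists j, A j k)) as [[j hj]|no].
    - exists (zs j k); intros i hi; destruct (classic (i = j)) as [->|ne]; auto.
      exfalso; apply (hA i j k (gone G) ne); [left| |rewrite gmul_1l]; auto.
    - exists (fun _ => (false, false), gone H); intros j hj; exfalso; eauto. }
  apply choice in h as [z hz]; exists z; split; auto.
Qed.

(** [marker_step] plants the patterns [h t z1] at bounded distance. For the [T] given by almost
    periodicity, some [h t] is invisible to the finitely many [H]-tests of [p], so the corresponding
    translate satisfies [p]. *)
Lemma syndetic_step n Z p : stage G H n Z -> (forall q, In q p -> depth q < n) ->
  (exists z, Z z /\ sat p z) ->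
  exists Z', stage G H n Z' /\ (forall z, Z' z -> Z z) /\ syndetic p Z'.
Proof.
  intros st bd [z1 [Zz1 sat1]].
  destruct (a_per (flat_map (fun q => match fst (fst q) with
    | inl _ => [] | inr (i, e) => [(i, e, snd (z1 (snd (fst q))))] end) p)) as [T hT].
  destruct (marker_step G H cG cG_inj infG n Z (map (fun q => snd (fst q)) p) z1 T
    st Zz1) as [Z' [S [st' [sub hZ']]]].
  exists Z'; split; auto; split; auto; exists (lmul G S S); intros z hz.
  destruct (hZ' z hz) as [s [h [hs hS]]]; destruct (hT h) as [t [ht per]].
  destruct (hS t ht) as [r [hr hw]]; exists (gmul G r s); split; [apply in_lmul; auto|].
  intros o k b hin; rewrite <- (sat1 o k b hin).
  destruct (hw k) as [e1 e2].
  { apply in_map_iff; exists ((o, k), b); auto. }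
  unfold shift; destruct o as [[i c]|[i e]]; simpl.
  - rewrite (e2 i); auto; apply (bd _ hin).
  - rewrite e1; simpl; apply per, in_flat_map; exists (inr (i, e), k, b).
    split; auto; left; auto.
Qed.

(** Step [n] first colours the identity and the element of code [n] differently in coordinate [n],
    then makes one pattern syndetic. The Cantor pairing returns to each pattern infinitely often,
    hence also at a step exceeding its depth. *)
Lemma next_stage (pcode : pattern -> nat) :
  (forall p q, pcode p = pcode q -> p = q) -> forall n Z, stage G H n Z ->
  exists Z', stage G H (S n) Z' /\ (forall z, Z' z -> Z z) /\
    (forall g z, cG g = n -> g <> gone G -> Z' z ->
       fst (z (gone G)) n <> fst (z g) n) /\
    forall p, pcode p = fst (Cantor.of_nat n) -> (forall q, In q p -> depth q < S n) ->
      (exists z, Z' z /\ sat p z) -> syndetic p Z'.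
Proof.
  intros pinj n Z st.
  assert (h : exists Z1, stage G H (S n) Z1 /\ (forall z, Z1 z -> Z z) /\
    forall g z, cG g = n -> g <> gone G -> Z1 z -> fst (z (gone G)) n <> fst (z g) n).
  { destruct (classic (exists g, cG g = n /\ g <> gone G)) as [[g [hg ne]]|no].
    - destruct (coloring_step G H cG cG_inj n Z g st ne) as [Z1 [st1 [sub h]]].
      exists Z1; split; auto; split; auto; intros g' z hg' _; rewrite <- hg in hg'.
      apply cG_inj in hg'; subst g'; auto.
    - exists Z; split; [apply stage_S, st|]; split; auto.
      intros g z hg ne; exfalso; eauto. }
  destruct h as [Z1 [st1 [sub1 col]]].
  destruct (classic (exists p, pcode p = fst (Cantor.of_nat n) /\
    (forall q, In q p -> depth q < S n) /\ exists z, Z1 z /\ sat p z))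
    as [[p [hp [bd ex]]]|no].
  - destruct (syndetic_step (S n) Z1 p st1 bd ex) as [Z' [st' [sub h]]].
    exists Z'; split; auto; split; auto; split; [eauto|].
    intros p' hp' _ _; replace p' with p; auto; apply pinj; congruence.
  - exists Z1; split; auto; split; auto; split; auto.
    intros p hp bd ex; exfalso; eauto.
Qed.

Lemma flow_exists : exists Y : (obs * G -> bool) -> Prop,
  pw_closed Y /\
  (forall g y, Y y -> Y (fun p => y (fst p, gmul G (snd p) g))) /\
  (forall h y, Y y -> Y (fun p => y (twist h (fst p), snd p))) /\
  (exists y, Y y /\ forall i e, y (inr (i, e), gone G) = a i e) /\
  (forall g y, Y y -> (forall p, y (fst p, gmul G (snd p) g) = y p) -> g = gone G) /\
  (forall y l, Y y -> exists S : list G, forall y', Y y' -> exists s, In s S /\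
     forall o k, In (o, k) l -> y' (o, gmul G k s) = y (o, k)).
Proof.
  assert (cI : countable (obs * G)).
  { apply countable_prod; [|exists cG; auto].
    apply countable_sum; apply countable_prod; auto using countable_nat, countable_bool. }
  destruct (countable_list _ (countable_prod _ _ cI countable_bool)) as [pcode pinj].
  destruct cI as [cI cI_inj].
  destruct (dependent_choice (stage G H) (fun n Z Z' => (forall z, Z' z -> Z z) /\
    (forall g z, cG g = n -> g <> gone G -> Z' z ->
       fst (z (gone G)) n <> fst (z g) n) /\
    forall p, pcode p = fst (Cantor.of_nat n) -> (forall q, In q p -> depth q < S n) ->
      (exists z, Z' z /\ sat p z) -> syndetic p Z') (fun _ => True) stage_top
    (next_stage pcode pinj)) as [Zs [_ hZs]].
  assert (st : forall n, stage G H n (Zs n)) by (intros n; apply hZs).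
  (* Only finite windows of [y] have to be readings of points of each stage; this gives a closed set
     although the stages need not be closed. *)
  pose (Y := fun y : obs * G -> bool => forall n l, exists z, Zs n z /\
    forall o k, In (o, k) l -> read o (z k) = y (o, k)).
  exists Y; split; [|split; [|split; [|split; [|split]]]].
  - intros y hy n l; destruct (hy l) as [y' [Yy' e]].
    destruct (Yy' n l) as [z [hz h]]; exists z; split; auto.
    intros o k hin; rewrite <- e; auto.
  - intros g y Yy n l.
    destruct (Yy n (map (fun p => (fst p, gmul G (snd p) g)) l)) as [z [hz h]].
    exists (shift G H g z); split; [apply (stage_shift _ _ _ _ (st n)), hz|].
    intros o k hin; apply h, in_map_iff; exists (o, k); auto.
  - intros h y Yy n l.
    destruct (Yy n (map (fun p => (twist h (fst p), snd p)) l)) as [z [hz e]].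
    exists (translate G H h z); split; [apply (stage_translate _ _ _ _ (st n)), hz|].
    intros o k hin; simpl; rewrite <- (e (twist h o) k).
    + destruct o as [[i b]|[i f]]; simpl; grp.
    + apply in_map_iff; exists (o, k); auto.
  (* Stages are nonempty by gluing an empty family. Translation normalises the [H]-component at the
     identity of [G] to the identity of [H], which gives [y] the values [a i e] there. *)
  - destruct (decreasing_limit cI (fun n b => exists z, Zs n z /\
      snd (z (gone G)) = gone H /\ b = fun p => read (fst p) (z (snd p))))
      as [y hy]; auto.
    + intros n b [z [hz h]]; exists z; split; auto; apply (hZs n), hz.
    + intros n; destruct (stage_gluing _ _ _ _ (st n)) as [D [_ gl]].
      destruct (gl False (fun _ _ => False) (fun j => match j with end)) as [z [hz _]];
        try (intros []).
      eexists; exists (translate G H (ginv H (snd (z (gone G)))) z); split.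
      * apply (stage_translate _ _ _ _ (st n)), hz.
      * split; [apply gmul_Vl|reflexivity].
    + exists y; split.
      * intros n l; destruct (hy n l) as [b [[z [hz [_ ->]]] e]]; exists z.
        split; auto; intros o k hin; apply (e (o, k) hin).
      * intros i e; destruct (hy 0 [(inr (i, e), gone G)]) as [b [[z [hz [z1 ->]]] q]].
        rewrite <- q by (left; auto); simpl; rewrite z1; grp.
  - intros g y Yy e; apply NNPP; intros ne.
    (* From stage [S (cG g)] on, the colours of the identity and of [g] differ in coordinate [cG g];
       these four tests read both colours. *)
    destruct (Yy (S (cG g)) [(inl (cG g, true), gone G); (inl (cG g, false), gone G);
      (inl (cG g, true), g); (inl (cG g, false), g)]) as [z [hz h]].
    destruct (hZs (cG g)) as [_ [_ [col _]]]; apply (col g z); auto.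
    apply injective_projections.
    + pose proof (h (inl (cG g, true))) as h'; simpl in h'; rewrite !h' by auto.
      rewrite <- e; simpl; grp.
    + pose proof (h (inl (cG g, false))) as h'; simpl in h'; rewrite !h' by auto.
      rewrite <- e; simpl; grp.
  - intros y l Yy; pose (p := map (fun i => (i, y i)) l).
    destruct (finite_bound depth p) as [N hN].
    (* Step [n] treats [p], and [n] is at least the depth bound [N]. *)
    pose (n := Cantor.to_nat (pcode p, N)).
    assert (hn : N <= n) by (pose proof (Cantor.to_nat_non_decreasing (pcode p) N);
      unfold n; lia).
    destruct (hZs n) as [_ [_ [_ syn]]]; destruct (syn p) as [S hS].
    + unfold n; rewrite Cantor.cancel_of_to; auto.
    + intros q hq; specialize (hN q hq); lia.
    + destruct (Yy (S n) l) as [z [hz e]]; exists z; split; auto.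
      intros o k b hin; apply in_map_iff in hin as [i [E hi]].
      injection E as -> <-; auto.
    + exists S; intros y' Yy'.
      (* The window contains the translates of [l] by all of [S], since [s] is known only after
         [z]. *)
      destruct (Yy' (Datatypes.S n) (flat_map (fun s =>
        map (fun i => (fst i, gmul G (snd i) s)) l) S)) as [z [hz e]].
      destruct (hS z hz) as [s [hs sz]]; exists s; split; auto; intros o k hin.
      rewrite <- e.
      * apply (sz o k); apply in_map_iff; exists (o, k); auto.
      * apply in_flat_map; exists s; split; auto; apply in_map_iff; exists (o, k); auto.
Qed.

End Flow.

(** * Assembly of the flow and its automorphisms *)

Theorem theorem11p5 (G H : Group) :
  countable G -> infinite G ->
  countable H -> maximally_almost_periodic H ->
  exists (Y : Type) (t : Topology Y) (act : G -> Y -> Y),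
    homeomorphic t cantor_topology /\
    is_flow G t act /\ minimal_flow G t act /\ free_flow G act /\
    embeds_into_Aut H G t act.
Proof.
  intros [cG cG_inj] infG cH mapH.
  destruct (almost_periodic_separation H cH mapH) as [a [a_sep a_per]].
  destruct (flow_exists G H cG cG_inj infG cH a a_per)
    as [Y [closedY [shY [trY [[y0 [Yy0 hy0]] [freeY minY]]]]]].
  pose (act := fun g (y : sig Y) => exist Y
    (fun p => proj1_sig y (fst p, gmul G (snd p) g)) (shY g _ (proj2_sig y))).
  pose (phi := fun h (y : sig Y) => exist Y
    (fun p => proj1_sig y (twist H h (fst p), snd p)) (trY h _ (proj2_sig y))).
  assert (act_mul : forall g h y, act (gmul G g h) y = act g (act h y)).
  { intros g h y; apply sig_ext; intros [o k]; simpl; grp. }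
  assert (act_free : free_flow G act).
  { intros g y e; apply (freeY g (proj1_sig y) (proj2_sig y)); intros p.
    exact (f_equal (fun y => proj1_sig y p) e). }
  assert (phi_mul : forall h1 h2 y, phi (gmul H h1 h2) y = phi h1 (phi h2 y)).
  { intros h1 h2 y; apply sig_ext; intros [[[i b]|[i e]] k]; simpl; grp. }
  assert (phi_1 : forall y, phi (gone H) y = y).
  { intros y; apply sig_ext; intros [[[i b]|[i e]] k]; simpl; grp. }
  assert (phi_cont : forall h, continuous (pw_topology Y) (pw_topology Y) (phi h)).
  { intros h; apply (pw_continuous Y _ (fun p => (twist H h (fst p), snd p))); auto. }
  exists (sig Y), (pw_topology Y), act; split; [|split; [|split; [|split]]].
  - assert (cI : countable (obs H * G)).
    { apply countable_prod; [|exists cG; auto].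
      apply countable_sum; apply countable_prod;
        auto using countable_nat, countable_bool. }
    destruct cI as [cI cI_inj].
    apply (homeomorphic_cantor Y cI cI_inj closedY); [|exists y0; auto].
    (* No point is isolated: some [s] in [S] brings [g y] back to [y] on [l]. If [y] were alone
       there, freeness would make [s] the inverse of [g], whereas [g] is chosen outside the inverses
       of [S]. *)
    intros y l; apply NNPP; intros no.
    destruct (minY (proj1_sig y) l (proj2_sig y)) as [S hS].
    destruct (infG (linv G S)) as [g hg]; apply hg, in_linv_inv.
    destruct (hS _ (proj2_sig (act g y))) as [s [hs e]].
    replace (ginv G g) with s; auto; apply (gmul_cancel_r G g); rewrite gmul_Vl.
    apply (act_free _ y); rewrite act_mul; apply NNPP; intros ne; apply no.
    exists (act s (act g y)); split; auto; intros [o k]; apply e.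
  - split; [|split; auto].
    + intros y; apply sig_ext; intros [o k]; simpl; grp.
    + intros g; apply (pw_continuous Y _ (fun p => (fst p, gmul G (snd p) g))); auto.
  - intros y U hU [x Ux]; destruct (hU x Ux) as [l hl].
    destruct (minY (proj1_sig x) l (proj2_sig x)) as [S hS].
    destruct (hS _ (proj2_sig y)) as [s [hs e]]; exists (act s y); split.
    + apply hl; intros [o k]; apply e.
    + exists s; auto.
  - exact act_free.
  - exists phi; split; [|split; auto].
    + intros h; split.
      * exists (phi (ginv H h)); split; [|split; [|split]]; auto;
          intros y; rewrite <- phi_mul; grp; apply phi_1.
      * intros g y; apply sig_ext; intros [o k]; reflexivity.
    + intros h1 h2 e; apply NNPP; intros ne.
      (* If [h1] and [h2] act alike, [h] fixes [y0]; the test [inr (h, gone H)] at the identity then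
         gives [a h h = a h (gone H)]. *)
      pose (h := gmul H (ginv H h1) h2).
      apply (a_sep h).
      * intros q; apply ne, (gmul_cancel_l H (ginv H h1)).
        fold h; rewrite q; apply gmul_Vl.
      * assert (fx : phi h (exist Y y0 Yy0) = exist Y y0 Yy0).
        { unfold h; rewrite phi_mul, <- e, <- phi_mul, gmul_Vl; apply phi_1. }
        apply (f_equal (fun y => proj1_sig y (inr (h, gone H), gone G))) in fx.
        simpl in fx; rewrite !hy0, gmul_1l in fx; exact fx.
Qed.
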